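(* Let $\mathcal M$ be a map on a surface with $n$ edges, let $E$ be its set of edges, identified with $[n]$, and let $A\subseteq E$. If $(X|Y)$ is a representation of the Lagrangian matroid $\Delta(\mathcal M)$, then a representation of the Lagrangian matroid $\Delta(\partial_A\mathcal M)$ of the partial dual $\partial_A\mathcal M$ is obtained from $(X|Y)$ by interchanging the columns $j$ and $j^*$ for all $j\in A$.
   Context: A map $\mathcal M$ on a surface $S$ is a cellular embedding of a connected graph (loops and multiple edges allowed) into a connected, closed, orientable surface $S$; the components of the complement are the faces. The dual map $\mathcal M^*$ on $S$ has one vertex (covertex) in each face of $\mathcal M$, and for each edge $j$ of $\mathcal M$ an edge (coedge) $j^*$ joining the face-centres of the face(s) on the two sides of $j$, crossing $j$ exactly once and meeting no other edge of $\mathcal M$. Write $E=[n]=\{1,\dots,n\}$ for the edges and $E^*=[n]^*=\{1^*,\dots,n^*\}$ for the coedges. An $n$-subset of $[n]\cup[n]^*$ is admissible if for each $j\in[n]$ it contains exactly one of $j,j^*$. A base of $\mathcal M$ is an admissible $n$-subset $B$ such that $S\setminus B$ (the complement of the union of the edges and coedges in $B$) is connected. The bases of $\mathcal M$ form the bases of a Lagrangian matroid $\Delta(\mathcal M)$, i.e. a collection $\mathcal B$ of admissible $n$-subsets such that for all $B_1,B_2\in\mathcal B$ and $j\in B_1\bigtriangleup B_2$ there is $k\in B_2\bigtriangleup B_1$ with $B_1\bigtriangleup\{j,k,j^*,k^*\}\in\mathcal B$. Representation: let $\mathbb F$ be a field of characteristic $0$ (e.g. $\mathbb Q$). A representation over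 $\mathbb F$ of a Lagrangian matroid with bases $\mathcal B$ on $[n]\cup[n]^*$ is an $n\times 2n$ matrix $(X|Y)$ over $\mathbb F$ of rank $n$, with $X,Y$ of size $n\times n$ and columns indexed by $[n]$ and $[n]^*$ respectively, such that $XY^t$ is anti-symmetric and such that an admissible $n$-subset $B$ lies in $\mathcal B$ if and only if the $n\times n$ minor of $(X|Y)$ on the columns indexed by $B$ is non-zero. Equivalently, the rows span a Lagrangian (maximal isotropic) subspace of the standard orthogonal space, the $2n$-dimensional space with basis $e_1,\dots,e_n,e_{1^*},\dots,e_{n^*}$ and symmetric bilinear form with $\langle e_i,e_{i^*}\rangle=\langle e_{i^*},e_i\rangle=1$ and $\langle e_i,e_j\rangle=0$ for $i\neq j^*$. Partial dual: divide each edge into two half-edges and label the half-edges by $\{1,\dots,2n\}$. Then $\mathcal M$ is encoded by $\langle\sigma,\alpha,\varphi\rangle$, $\sigma,\alpha,\varphi\in S_{2n}$, where cycles of $\sigma$, $\alpha$, $\varphi$ are the counter-clockwise cyclic orderings of half-edge labels around vertices, around edge midpoints, and within faces, respectively; $\alpha$ is a fixed-point free involution, $\sigma\alpha\varphi=1$ (permutations act on the right), and the group generated is transitive; conversely such a triple determines a map up to isomorphism. Write $\alpha=c_1\cdots c_n$ as a product of disjoint transpositions, $c_j$ corresponding to edge $j$. For $A=\{i_1,\dots,i_k\}\subseteq E$, $\partial_A\mathcal M=\langle\sigma c_{i_1}\cdots c_{i_k},\alpha,c_{i_1}\cdots c_{i_k}\varphi\rangle$. Its edge $j$ is again the one corresponding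 to $c_j$, and its coedge is again denoted $j^*$, so $\Delta(\partial_A\mathcal M)$ is a Lagrangian matroid on the same set $[n]\cup[n]^*$. *)

(* Defs.v *)
From HB Require Import structures.
From Stdlib Require Import Relations.
From mathcomp Require Import all_boot all_order all_algebra all_fingroup.
From mathcomp Require Import generic_quotient.
From mathcomp Require Import all_classical all_reals all_analysis.
From mathcomp Require Import lra.

Set Implicit Arguments.
Unset Strict Implicit.
Unset Printing Implicit Defensive.

Import Order.TTheory GRing.Theory Num.Theory.
Import numFieldNormedType.Exports.

Local Open Scope classical_set_scope.
Local Open Scope ring_scope.
Local Open Scope quotient_scope.

(* Half-edges are 0, ..., 2n-1. Permutations compose on the right in MathComp,
   [(s * t)%g h = t (s h)], which is the convention under which
   [sigma * alpha * phi = 1]. The factorisation of [alpha] into the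
   transpositions [cyc j] is what numbers the edges. Transitivity is spelt out
   pointwise because [atrans] is false on the empty set, and n = 0 (one vertex
   on the sphere) is a map. *)
Record smap (n : nat) := Smap {
  sigma : {perm 'I_n.*2};
  alpha : {perm 'I_n.*2};
  phi : {perm 'I_n.*2};
  cyc : 'I_n -> {perm 'I_n.*2};
  alpha_fixfree : forall h, alpha h != h;
  alpha_invol : (alpha * alpha = 1)%g;
  sigma_alpha_phi : (sigma * alpha * phi = 1)%g;
  smap_transitive : forall h h',
    h' \in orbit 'P <<[set sigma; alpha; phi]%SET>>%g h;
  cyc_transp : forall j, exists h h', h != h' /\ cyc j = tperm h h';
  cyc_disjoint : forall i j h, i != j -> cyc i h = h \/ cyc j h = h;
  alpha_prod : alpha = (\prod_(j < n) cyc j)%g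
}.

Definition cprod n (M : smap n) (A : {set 'I_n}) : {perm 'I_n.*2} :=
  (\prod_(j in A) cyc M j)%g.

Section PartialDual.
Variables (n : nat) (M : smap n).

Lemma cyc_invol j h : cyc M j (cyc M j h) = h.
Proof. by have [x [y [_ ->]]] := cyc_transp M j; rewrite tpermK. Qed.

Lemma cyc_moved i j h : cyc M i h != h -> i != j -> cyc M j h = h.
Proof. by move=> /eqP hi /(cyc_disjoint M h)[]. Qed.

Lemma prod_cyc_fix (r : seq 'I_n) h :
  (forall i, i \in r -> cyc M i h = h) -> (\prod_(i <- r) cyc M i)%g h = h.
Proof.
elim: r => [|i r IHr] hr; first by rewrite big_nil perm1.
rewrite big_cons permM hr ?mem_head// IHr// => k kr.
by rewrite hr// inE kr orbT.
Qed.

Lemma cyc_movedJ j h : cyc M j h != h -> cyc M j (cyc M j h) != cyc M j h.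
Proof. by rewrite cyc_invol eq_sym. Qed.

Lemma prod_cyc_moved (r : seq 'I_n) j h : uniq r -> cyc M j h != h ->
  (\prod_(i <- r) cyc M i)%g h = if j \in r then cyc M j h else h.
Proof.
move=> + hj; elim: r => [|i r IHr]; first by rewrite big_nil perm1.
rewrite cons_uniq => /andP[ir ur]; rewrite big_cons permM inE.
have [ji|ji] := eqVneq j i; last by rewrite (cyc_moved hj ji) IHr.
rewrite ji in hj *; rewrite prod_cyc_fix// => k kr.
have ik : i != k by apply: contraNneq ir => ->.
exact: cyc_moved (cyc_movedJ hj) ik.
Qed.

Let ordered (A : {set 'I_n}) := [seq i <- index_enum 'I_n | i \in A].

Lemma cprodE A : cprod M A = (\prod_(i <- ordered A) cyc M i)%g.
Proof. by rewrite /cprod big_filter. Qed.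

Lemma alpha_cprod : alpha M = cprod M [set: 'I_n]%SET.
Proof.
by rewrite alpha_prod /cprod; apply: eq_bigl => j; rewrite inE.
Qed.

Lemma edge_of h : exists j, cyc M j h != h.
Proof.
apply/existsP; apply: contraTT (alpha_fixfree M h) => /existsPn hj.
rewrite alpha_cprod cprodE prod_cyc_fix ?eqxx// => i _.
by apply/eqP; have := hj i; rewrite negbK.
Qed.

Lemma cprod_moved A j h : cyc M j h != h ->
  cprod M A h = if j \in A then cyc M j h else h.
Proof.
move=> hj; rewrite cprodE (prod_cyc_moved _ hj) ?filter_uniq ?index_enum_uniq//.
by rewrite mem_filter mem_index_enum andbT.
Qed.

Lemma alpha_moved j h : cyc M j h != h -> alpha M h = cyc M j h.
Proof. by move=> hj; rewrite alpha_cprod (cprod_moved _ hj) inE. Qed.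

Lemma cprod_cases A h : cprod M A h = h \/ cprod M A h = alpha M h.
Proof.
have [j hj] := edge_of h; rewrite (cprod_moved A hj) (alpha_moved hj).
by case: ifP; [right|left].
Qed.

Lemma cprod_invol A h : cprod M A (cprod M A h) = h.
Proof.
have [j hj] := edge_of h; rewrite !(cprod_moved A hj).
case: ifPn => jA; last by rewrite (cprod_moved A hj) (negbTE jA).
by rewrite (cprod_moved A (cyc_movedJ hj)) jA cyc_invol.
Qed.

Lemma cprod_alpha A h : cprod M A (alpha M h) = alpha M (cprod M A h).
Proof.
have [j hj] := edge_of h; rewrite (alpha_moved hj) (cprod_moved A hj).
rewrite (cprod_moved A (cyc_movedJ hj)); case: ifP => _.
  by rewrite (alpha_moved (cyc_movedJ hj)).
by rewrite (alpha_moved hj).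
Qed.

Variable A : {set 'I_n}.
Let s' := (sigma M * cprod M A)%g.
Let p' := (cprod M A * phi M)%g.

Lemma pdual_prod : (s' * alpha M * p' = 1)%g.
Proof.
rewrite -(sigma_alpha_phi M); apply/permP => h.
by rewrite !permM -cprod_alpha cprod_invol.
Qed.

Lemma pdual_transitive h h' :
  h' \in orbit 'P <<[set s'; alpha M; p']%SET>>%g h.
Proof.
set G := <<_>>%g.
have sG : s' \in G by rewrite mem_gen// !inE eqxx.
have aG : alpha M \in G by rewrite mem_gen// !inE eqxx orbT.
have stepG x g : g \in G -> x \in orbit 'P G h -> g x \in orbit 'P G h.
  by move=> gG /orbit_eqP <-; exact: mem_orbit.
have cO x : x \in orbit 'P G h -> cprod M A x \in orbit 'P G h.
  by move=> xO; case: (cprod_cases A x) => ->//; exact: stepG.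
have sO x : x \in orbit 'P G h -> sigma M x \in orbit 'P G h.
  by move=> xO; have := cO _ (stepG _ _ sG xO); rewrite permM cprod_invol.
have pO x : x \in orbit 'P G h -> phi M x \in orbit 'P G h.
  have pG : p' \in G by rewrite mem_gen// !inE eqxx !orbT.
  by move=> xO; have := stepG _ _ pG (cO _ xO); rewrite permM cprod_invol.
have : [acts <<[set sigma M; alpha M; phi M]%SET>>%g, on orbit 'P G h | 'P].
  rewrite gen_subG; apply/fintype.subsetP => g; rewrite !inE => gE.
  apply/fintype.subsetP => x; rewrite inE /= /aperm => xO.
  by case/orP: gE => [/orP[]|] /eqP->; [exact: sO|exact: stepG|exact: pO].
move=> /acts_sub_orbit sub; have := sub h.
rewrite orbit_refl => /fintype.subsetP; apply; exact: smap_transitive.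
Qed.

Definition partial_dual : smap n :=
  Smap (alpha_fixfree M) (alpha_invol M) pdual_prod pdual_transitive
    (cyc_transp M) (cyc_disjoint M) (alpha_prod M).

End PartialDual.

Section Surface.
Variables (R : realType) (n : nat) (M : smap n).

(* The surface is glued from one square per half-edge h, the corner between h
   and [sigma h]: vertex at (0,0), x-axis the half-edge h, y-axis the half-edge
   [sigma h], edge midpoints at (1,0) and (0,1), face centre at (1,1), and
   hence the sides x = 1 and y = 1 are the halves of the coedges crossing h and
   [sigma h]. Crossing x = 0 leads counter-clockwise around the vertex to the
   corner of [sigma h]; crossing x = 1 leads counter-clockwise around the face
   centre to the corner of [phi h]. The squares around a midpoint are permuted
   by [phi] then [sigma], i.e. by [alpha]. *)
Definition unit_itv : set R := `[0, 1].
Definition corner : topologicalType := (unit_itv * unit_itv)%type.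
Definition corners : topologicalType := {h : 'I_n.*2 & (fun=> corner) h}.

Definition xcoord (p : corners) : R := set_val (tagged p).1.
Definition ycoord (p : corners) : R := set_val (tagged p).2.

Definition glue (p q : corners) : Prop :=
  [/\ tag q = sigma M (tag p), xcoord p = 0, ycoord q = 0
    & ycoord p = xcoord q] \/
  [/\ tag q = phi M (tag p), xcoord p = 1, ycoord q = 1
    & ycoord p = xcoord q].

Definition glue_eqv (p q : corners) : bool :=
  `[< clos_refl_sym_trans corners glue p q >].

Lemma glue_eqv_refl : reflexive glue_eqv.
Proof. by move=> p; apply/asboolP/rst_refl. Qed.

Lemma glue_eqv_sym : symmetric glue_eqv.
Proof. by move=> p q; apply/asboolP/asboolP; apply: rst_sym. Qed.

Lemma glue_eqv_trans : transitive glue_eqv.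
Proof.
by move=> q p r /asboolP pq /asboolP qr; apply/asboolP/(rst_trans _ _ _ q).
Qed.

Canonical glue_rel :=
  EquivRel glue_eqv glue_eqv_refl glue_eqv_sym glue_eqv_trans.

(* For n = 0 this is the empty space rather than the sphere; both are
   connected, so the bases below are the same. *)
Definition surface : topologicalType := quotient_topology {eq_quot glue_rel}.

Definition to_surface (p : corners) : surface := \pi_({eq_quot glue_rel}) p.

(* Edges and coedges are closed arcs (or loops): they contain their ends. *)
Definition edge (j : 'I_n) : set surface :=
  to_surface @` [set p | cyc M j (tag p) != tag p /\ ycoord p = 0].

Definition coedge (j : 'I_n) : set surface :=
  to_surface @` [set p | cyc M j (tag p) != tag p /\ xcoord p = 1].

End Surface.

Arguments to_surface R {n} M p.
Arguments edge R {n} M j.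
Arguments coedge R {n} M j.

(* [inl j] is the edge j, [inr j] the coedge j^*. *)
Definition ground (n : nat) : finType := ('I_n + 'I_n)%type.

Definition star n (b : ground n) : ground n :=
  match b with inl j => inr j | inr j => inl j end.

Definition symdiff (T : finType) (B C : {set T}) : {set T} :=
  (B :\: C) :|: (C :\: B).

Definition admissible n (B : {set ground n}) : Prop :=
  #|B| = n /\ forall j, (inl j \in B) != (inr j \in B).

Record lagrangian_matroid (n : nat) := LagrangianMatroid {
  bases : set {set ground n};
  bases_admissible : forall B, bases B -> admissible B;
  bases_exchange : forall B1 B2 j, bases B1 -> bases B2 ->
    j \in symdiff B1 B2 ->
    exists2 k, k \in symdiff B2 B1 &
      bases (symdiff B1 [set j; k; star j; star k]%SET)
}.

Section MapBases.
Variables (R : realType) (n : nat) (M : smap n).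

Definition arc (b : ground n) : set (surface R M) :=
  match b with inl j => edge R M j | inr j => coedge R M j end.

Definition map_base (B : {set ground n}) : Prop :=
  admissible B /\ connected (~` \bigcup_(b in [set` B]) arc b).

End MapBases.

Arguments arc R {n} M b.
Arguments map_base R {n} M B.

(* Proof of the exchange property. The squares not separated by the arcs in an
   admissible B form cycles, namely those of the permutation [walk] below, so
   that B is a base if and only if [walk] is transitive ([map_base_walk]). *)
Module MapBaseFacts.

Section EdgeAt.
Variables (n : nat) (M : smap n).

Lemma edge_atP h : exists j, cyc M j h != h. Proof. exact: edge_of. Qed.
Definition edge_at h : 'I_n := xchoose (edge_atP h).

Lemma edge_atE j h : (cyc M j h != h) = (edge_at h == j).
Proof.
have eh := xchooseP (edge_atP h); rewrite -/(edge_at h) in eh.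
apply/idP/eqP => [jh|<-//]; apply/eqP; apply: contraTT eh => ne.
by rewrite negbK; apply/eqP; apply: cyc_moved jh _; rewrite eq_sym.
Qed.

Lemma cprod_at A h : cprod M A h = if edge_at h \in A then alpha M h else h.
Proof.
have eh : cyc M (edge_at h) h != h by rewrite edge_atE.
by rewrite (cprod_moved A eh) (alpha_moved eh).
Qed.

Lemma alphaK : involutive (alpha M).
Proof. by move=> h; rewrite -permM alpha_invol perm1. Qed.

Lemma edge_at_alpha h : edge_at (alpha M h) = edge_at h.
Proof.
have eh : cyc M (edge_at h) h != h by rewrite edge_atE.
by apply/eqP; rewrite -edge_atE (alpha_moved eh) cyc_movedJ.
Qed.

Lemma sigma_phi h : sigma M (phi M h) = alpha M h.
Proof.
have /permP/(_ ((sigma M)^-1%g (alpha M h))) := sigma_alpha_phi M.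
by rewrite !permM perm1 permKV alphaK => ->; rewrite permKV.
Qed.

End EdgeAt.

Section Topology.
Variables (R : realType) (n : nat) (M : smap n) (e : {set 'I_n}).
Local Notation s := (sigma M).
Local Notation f := (phi M).
Local Notation a := (alpha M).
Local Notation eat := (edge_at M).

Definition walk : {perm 'I_n.*2} := (s * cprod M e)%g.

Lemma walkE h : walk h = if eat (s h) \in e then a (s h) else s h.
Proof. by rewrite permM cprod_at. Qed.

Definition clip_fun (x : R) : R := Num.max 0 (Num.min 1 x).
Lemma clip_proof x : clip_fun x \in @unit_itv R.
Proof.
apply/mem_set; rewrite /unit_itv /= in_itv /= /clip_fun.
by rewrite le_max lexx ge_max ler01 ge_min lexx.
Qed.
Definition clip (x : R) : @unit_itv R := exist (fun t => t \in @unit_itv R) _ (clip_proof x).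

Lemma clipE x : 0 <= x <= 1 -> set_val (clip x) = x.
Proof.
move=> /andP[x0 x1]; rewrite set_valE /= /clip_fun.
by rewrite (min_idPr x1) (max_idPr x0).
Qed.

Lemma set_valK (x : @unit_itv R) : 0 <= (set_val x : R) <= 1.
Proof. by have := set_valP x; rewrite /unit_itv /= in_itv. Qed.

Lemma clipK (x : @unit_itv R) : clip (set_val x) = x.
Proof. by apply: val_inj; have := clipE (set_valK x); rewrite !set_valE. Qed.

Definition mk (h : 'I_n.*2) (x y : R) : corners R n :=
  existT (fun=> corner R) h (clip x, clip y).

Lemma mkE (p : corners R n) : p = mk (tag p) (xcoord p) (ycoord p).
Proof.
by case: p => h [x y]; rewrite /mk /xcoord /ycoord /= !clipK.
Qed.

Lemma xrange (p : corners R n) : 0 <= xcoord p <= 1. Proof. exact: set_valK. Qed.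
Lemma yrange (p : corners R n) : 0 <= ycoord p <= 1. Proof. exact: set_valK. Qed.
Lemma xmk h x y : 0 <= x <= 1 -> xcoord (mk h x y) = x. Proof. exact: clipE. Qed.
Lemma ymk h x y : 0 <= y <= 1 -> ycoord (mk h x y) = y. Proof. exact: clipE. Qed.

Lemma to_surfaceP (p q : corners R n) :
  to_surface R M p = to_surface R M q <->
  clos_refl_sym_trans _ (glue M) p q.
Proof.
split=> [/(@eqquotP _ _ {eq_quot glue_rel R M}) /asboolP //|pq].
by apply/(@eqquotP _ _ {eq_quot glue_rel R M})/asboolP.
Qed.

Lemma to_surface_repr (u : surface R M) :
  exists p, to_surface R M p = u.
Proof. by exists (repr u); rewrite /to_surface reprK. Qed.

Lemma glueV h t : 0 <= t <= 1 ->
  to_surface R M (mk h 0 t) = to_surface R M (mk (s h) t 0).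
Proof.
move=> t01; apply/to_surfaceP/rst_step; left.
by rewrite !xmk ?ymk ?lexx ?ler01.
Qed.

Lemma glueF h t : 0 <= t <= 1 ->
  to_surface R M (mk h 1 t) = to_surface R M (mk (f h) t 1).
Proof.
move=> t01; apply/to_surfaceP/rst_step; right.
by rewrite !xmk ?ymk ?lexx ?ler01.
Qed.

Definition onB (p : corners R n) : Prop :=
  let h := tag p in let x := xcoord p in let y := ycoord p in
  ((eat h \in e /\ y = 0) \/ (eat h \notin e /\ x = 1)) \/
  ((eat (s h) \in e /\ x = 0) \/ (eat (s h) \notin e /\ y = 1)) \/
  ((exists2 h', h' \in porbit s h & eat h' \in e) /\ (x = 0 /\ y = 0)) \/
  ((exists2 h', h' \in porbit f h & eat h' \notin e) /\ (x = 1 /\ y = 1)).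

Lemma porbit_step (g : {perm 'I_n.*2}) h : porbit g (g h) = porbit g h.
Proof. by apply/esym/eqP; rewrite eq_porbit_mem porbit_sym; have := mem_porbit g 1 h. Qed.

Lemma eat_sf h : eat (s (f h)) = eat h.
Proof. by rewrite sigma_phi edge_at_alpha. Qed.

Lemma onB_glue p q : glue M p q -> (onB p <-> onB q).
Proof.
rewrite /onB /glue; move: (tag p) (tag q) => h k /=.
case=> -[-> -> -> ->].
- have n01 : 0 <> 1 :> R by apply/eqP; rewrite eq_sym oner_eq0.
  have n10 : 1 <> 0 :> R by apply/eqP; rewrite oner_eq0.
  split.
  + case=> [[[H ->]|[_ /n01//]]|[[[H _]|[H ->]]|[[H [_ ->]]|[_ [/n01//]]]]].
    * right; right; left; split=> //; exists h => //.
      by rewrite porbit_step porbit_id.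
    * by left; left.
    * by left; right.
    * by right; right; left; split=> //; rewrite porbit_step.
  + case=> [[[H _]|[H ->]]|[[[H ->]|[_ /n01//]]|[[H [-> _]]|[_ [_ /n01//]]]]].
    * by right; left; left.
    * by right; left; right.
    * right; right; left; split=> //; exists (s (s h)) => //.
      by rewrite -(porbit_step s h) -(porbit_step s (s h)) porbit_id.
    * by right; right; left; split=> //; rewrite -porbit_step.
- have n01 : 0 <> 1 :> R by apply/eqP; rewrite eq_sym oner_eq0.
  have n10 : 1 <> 0 :> R by apply/eqP; rewrite oner_eq0.
  rewrite eat_sf; split.
  + case=> [[[H ->]|[H _]]|[[[_ /n10//]|[H ->]]|[[_ [/n10//]]|[H [_ ->]]]]].
    * by right; left; left.
    * by right; left; right.
    * right; right; right; split=> //; exists ((f^-1)%g h).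
        by rewrite porbit_step porbit_sym; have := mem_porbit f 1 ((f^-1)%g h);
           rewrite expg1 permKV.
      by rewrite -(eat_sf ((f^-1)%g h)) permKV.
    * by right; right; right; split=> //; rewrite porbit_step.
  + case=> [[[_ /n10//]|[H ->]]|[[[H ->]|[H _]]|[[_ [_ /n10//]]|[H [-> _]]]]].
    * right; right; right; split=> //; exists (f h) => //.
      by rewrite -(porbit_step f h) porbit_id.
    * by left; left.
    * by left; right.
    * by right; right; right; split=> //; rewrite -porbit_step.
Qed.

Lemma onB_rst p q : clos_refl_sym_trans _ (glue M) p q -> (onB p <-> onB q).
Proof. by elim=> // {p q} [p q /onB_glue|p q _ <-|p q r _ -> _ <-]. Qed.

Lemma walk_glue p q : glue M p q -> ~ onB p ->
  porbit walk (tag p) = porbit walk (tag q).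
Proof.
rewrite /onB /glue; move: (tag p) (tag q) => h k /=.
case=> -[-> -> _ _] nB.
- rewrite -(porbit_step walk h) walkE; case: ifP => // sh.
  by case: nB; right; left; left.
- rewrite -(porbit_step walk (f h)) walkE eat_sf; case: ifPn => sh.
    by rewrite sigma_phi alphaK.
  by case: nB; left; right.
Qed.

Lemma walk_rst p q : clos_refl_sym_trans _ (glue M) p q -> ~ onB p ->
  porbit walk (tag p) = porbit walk (tag q).
Proof.
elim=> // {p q} [p q /walk_glue //|p q pq IH nq|p q r pq IHpq qr IHqr np].
  by rewrite IH// (onB_rst pq).
by rewrite IHpq// IHqr// -(onB_rst pq).
Qed.

Variable B : {set ground n}.
Hypothesis Badm : admissible B.
Hypothesis Be : forall j, (j \in e) = (inl j \in B).
Let BU := \bigcup_(b in [set` B]) arc R M b.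

Lemma inrB j : (inr j \in B) = (j \notin e).
Proof. by have := Badm.2 j; rewrite Be; do 2!case: (_ \in B). Qed.

Lemma BU_V t h : eat h \in e -> 0 <= t <= 1 -> BU (to_surface R M (mk h t 0)).
Proof.
move=> he t01; exists (inl (eat h)); first by rewrite /= -Be.
by exists (mk h t 0) => //=; rewrite edge_atE ymk ?lexx ?ler01.
Qed.

Lemma BU_F t h : eat h \notin e -> 0 <= t <= 1 -> BU (to_surface R M (mk h 1 t)).
Proof.
move=> he t01; exists (inr (eat h)); first by rewrite /= inrB.
by exists (mk h 1 t) => //=; rewrite edge_atE xmk ?lexx ?ler01.
Qed.

Lemma BU_onB p : BU (to_surface R M p) <-> onB p.
Proof.
split.
  case=> -[] j /= jB [q /= [jq q0] /to_surfaceP /onB_rst <-].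
    left; left; split=> //; move: jq; rewrite edge_atE => /eqP ->.
    by rewrite Be.
  left; right; split=> //; move: jq; rewrite edge_atE => /eqP ->.
  by rewrite -inrB.
have i0 : 0 <= (0 : R) <= 1 by rewrite lexx ler01.
have i1 : 0 <= (1 : R) <= 1 by rewrite lexx ler01.
rewrite {2}(mkE p); have := xrange p; have := yrange p; rewrite /onB.
move: (tag p) (xcoord p) (ycoord p) => h x y yr xr.
case=> [[[H ->]|[H ->]]|[[[H ->]|[H ->]]|[[[h' H H'] [-> ->]]|[[h' H H'] [-> ->]]]]].
- exact: BU_V.
- exact: BU_F.
- by rewrite glueV//; exact: BU_V.
- have -> : h = f (f^-1%g h) by rewrite permKV.
  by rewrite -glueF//; apply: BU_F; rewrite // -eat_sf permKV.
- have /porbitP[i ->] : h \in porbit s h' by rewrite porbit_sym.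
  elim: i => [|i IHi]; first by rewrite expg0 perm1; exact: BU_V.
  by rewrite expgSr permM -glueV.
- have /porbitP[i ->] : h \in porbit f h' by rewrite porbit_sym.
  elim: i => [|i IHi]; first by rewrite expg0 perm1; exact: BU_F.
  by rewrite expgSr permM -glueF.
Qed.

Definition ctr h : corners R n := mk h 2^-1 2^-1.

Lemma inner_onB h x y : 0 < x < 1 -> 0 < y < 1 -> ~ onB (mk h x y).
Proof.
move=> /andP[x0 x1] /andP[y0 y1]; rewrite /onB xmk ?ymk ?ltW//.
have nx0 : x <> 0 by apply/eqP; rewrite gt_eqF.
have nx1 : x <> 1 by apply/eqP; rewrite lt_eqF.
have ny0 : y <> 0 by apply/eqP; rewrite gt_eqF.
have ny1 : y <> 1 by apply/eqP; rewrite lt_eqF.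
by tauto.
Qed.

Lemma ctr_onB h : ~ onB (ctr h).
Proof. by apply: inner_onB; lra. Qed.

Lemma closed_onB h : closed [set z : corner R | onB (existT (fun=> corner R) h z)].
Proof.
have cx : continuous (fun z : corner R => set_val z.1 : R).
  move=> z; apply: (@continuous_comp _ _ _ fst) => //; first exact: cvg_fst.
  exact: initial_continuous.
have cy : continuous (fun z : corner R => set_val z.2 : R).
  move=> z; apply: (@continuous_comp _ _ _ snd) => //; first exact: cvg_snd.
  exact: initial_continuous.
have clx r : closed [set z : corner R | set_val z.1 = r :> R].
  by apply: (@preimage_closed _ _ _ [set r]) => [z _|]; [exact: cx|exact: closed_eq].
have cly r : closed [set z : corner R | set_val z.2 = r :> R].
  by apply: (@preimage_closed _ _ _ [set r]) => [z _|]; [exact: cy|exact: closed_eq].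
have clP (P : Prop) (X : set (corner R)) : closed X -> closed [set z | P /\ X z].
  move=> cX; have [HP|HP] := pselect P.
    by rewrite (_ : [set z | _] = X)//; apply/seteqP; split=> z // -[].
  rewrite (_ : [set z | _] = set0); first exact: closed0.
  by apply/seteqP; split=> z // -[].
rewrite /onB /xcoord /ycoord /=.
do ![apply: closedU | apply: clP | apply: closedI | exact: clx | exact: cly].
Qed.

Definition region (C : {set 'I_n.*2}) : set (surface R M) :=
  [set u | ~ BU u /\ exists2 p, to_surface R M p = u & tag p \in C].

Lemma region_open (C : {set 'I_n.*2}) :
  (forall k l, porbit walk k = porbit walk l -> (k \in C) = (l \in C)) -> open (region C).
Proof.
move=> CE; rewrite /open /= /quotient_open.
rewrite (_ : _ @^-1` _ = [set p | ~ onB p /\ tag p \in C]); last first.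
  apply/seteqP; split=> p /=.
    move=> [/BU_onB np [q /to_surfaceP qp qC]]; split=> //.
    by rewrite -(CE _ _ (walk_rst qp _))// => /(onB_rst qp).
  by move=> [np pC]; split; [move/BU_onB|exists p].
apply/sigT_openP => k.
have [kC|kC] := boolP (k \in C); last first.
  rewrite (_ : _ @^-1` _ = set0); first exact: open0.
  by apply/seteqP; split=> z //= -[_]; rewrite (negbTE kC).
rewrite (_ : _ @^-1` _ = ~` [set z : corner R | onB (existT (fun=> corner R) k z)]).
  exact/closed_openC/closed_onB.
by apply/seteqP; split=> z //= -[].
Qed.


Lemma connected_walk : connected (~` BU) -> forall h k, k \in porbit walk h.
Proof.
move=> cU h k; pose C := porbit walk h.
have CE x y : porbit walk x = porbit walk y -> (x \in C) = (y \in C).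
  by move=> xy; rewrite /C !(porbit_sym _ _ h) xy.
have CE' x y : porbit walk x = porbit walk y -> (x \in ~: C) = (y \in ~: C).
  by move=> xy; rewrite !inE (CE _ _ xy).
have ctrU x : (~` BU) (to_surface R M (ctr x)) by move=> /BU_onB/ctr_onB.
have regU : region C = ~` BU.
  apply: cU.
  - exists (to_surface R M (ctr h)); split; first exact: ctrU.
    by exists (ctr h) => //; exact: porbit_id.
  - exists (region C); first exact: region_open.
    by rewrite setIC; apply/esym/setIidPl => u [].
  - exists (~` region (~: C)); first exact/open_closedC/region_open.
    apply/seteqP; split=> u.
      move=> [nu [p pu pC]]; split=> // -[_ [q qu]]; rewrite inE => /negP; apply.
      have /to_surfaceP pq : to_surface R M p = to_surface R M q by rewrite pu.
      by rewrite -(CE _ _ (walk_rst pq _))// => /BU_onB; rewrite pu.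
    move=> [nu nr]; split=> //; have [p pu] := to_surface_repr u.
    exists p => //; apply: contrapT => /negP pC; apply: nr; split=> //.
    by exists p => //; rewrite inE.
have := ctrU k; rewrite -regU => -[nk [p /to_surfaceP pk]].
by rewrite (CE _ _ (walk_rst pk _))// => /(onB_rst pk)/ctr_onB.
Qed.

Lemma clip_continuous : continuous clip.
Proof.
apply/continuous_comp_initial => x /=.
rewrite (_ : _ \o _ = clip_fun); last by apply/funext => y; rewrite /= set_valE.
apply: continuous_max; first exact: cvg_cst.
by apply: continuous_min; [exact: cvg_cst|exact: cvg_id].
Qed.

Lemma to_ctr p : ~ onB p ->
  connected_component (~` BU) (to_surface R M (ctr (tag p))) (to_surface R M p).
Proof.
rewrite (mkE p) => np; rewrite [tag (mk _ _ _)]/=.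
move: (xrange p) (yrange p) np; move: (tag p) (xcoord p) (ycoord p).
move=> h x y /andP[x0 x1] /andP[y0 y1] np.
pose g (t : R) := to_surface R M (mk h (x + (2^-1 - x) * t) (y + (2^-1 - y) * t)).
exists (g @` `[0, 1]); last first.
  by exists 0; rewrite /= ?in_itv/= ?lexx ?ler01// /g !mulr0 !addr0.
split.
- exists 1; rewrite /= ?in_itv/= ?lexx ?ler01// /g !mulr1.
  by rewrite addrC subrK addrC subrK.
- move=> v [t /=]; rewrite in_itv /= => /andP[t0 t1] <- /BU_onB.
  have [->|tn0] := eqVneq t 0; first by rewrite !mulr0 !addr0.
  have tp : 0 < t by rewrite lt_neqAle eq_sym tn0.
  by apply: inner_onB; apply/andP; split; nra.
- apply: connected_continuous_connected; first exact: segment_connected.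
  apply: continuous_subspaceT => t.
  pose gx (t : R) : corner R := (clip (x + (2^-1 - x) * t), clip (y + (2^-1 - y) * t)).
  apply: (@continuous_comp _ _ _ (existT (fun=> corner R) h \o gx) (to_surface R M));
    last exact: pi_continuous.
  apply: (@continuous_comp _ _ _ gx (existT (fun=> corner R) h));
    last exact: existT_continuous.
  have lin (u v : R) : {for t, continuous (fun t : R => clip (u + v * t))}.
    apply: (@continuous_comp _ _ _ (fun t : R => u + v * t) clip);
      last exact: clip_continuous.
    apply: cvgD; first exact: cvg_cst.
    by apply: cvgM; [exact: cvg_cst|exact: cvg_id].
  exact: cvg_pair (lin _ _) (lin _ _).
Qed.

Lemma ctr_walk h : connected_component (~` BU)
  (to_surface R M (ctr h)) (to_surface R M (ctr (walk h))).
Proof.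
have h0 : (0 : R) < 2^-1 by rewrite invr_gt0 ltr0n.
have h1 : (2^-1 : R) < 1 by lra.
have hh : 0 <= (2^-1 : R) <= 1 by rewrite !ltW.
have nh0 : (2^-1 : R) <> 0 by lra.
have nh1 : (2^-1 : R) <> 1 by lra.
have i0 : 0 <= (0 : R) <= 1 by rewrite lexx ler01.
have i1 : 0 <= (1 : R) <= 1 by rewrite lexx ler01.
have n01 : (0 : R) <> 1 by lra.
have n10 : (1 : R) <> 0 by lra.
have meet p q : to_surface R M p = to_surface R M q -> ~ onB p ->
    connected_component (~` BU) (to_surface R M (ctr (tag p)))
      (to_surface R M (ctr (tag q))).
  move=> pq np; have /to_surfaceP pqr := pq.
  apply: connected_component_trans (to_ctr np) _.
  rewrite pq; apply/connected_component_sym/to_ctr.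
  by move/(onB_rst pqr).
rewrite walkE; case: ifPn => sh.
- pose k := a (s h).
  have fk : f k = h.
    by apply: (@perm_inj _ s); rewrite sigma_phi alphaK.
  apply: (meet (mk h 2^-1 1) (mk k 1 2^-1)); first by rewrite glueF// fk.
  rewrite /onB xmk ?ymk// [tag _]/= sh.
  by case=> [[[_ //]|[_ //]]|[[[_ //]|[//]]|[[_ [//]]|[_ [//]]]]].
- apply: (meet (mk h 0 2^-1) (mk (s h) 2^-1 0)); first by rewrite glueV.
  rewrite /onB xmk ?ymk// [tag _]/= (negbTE sh).
  by case=> [[[_ //]|[_ //]]|[[[//]|[_ //]]|[[_ [_ //]]|[_ [//]]]]].
Qed.

Lemma walk_connected : (forall h k, k \in porbit walk h) -> connected (~` BU).
Proof.
move=> W; have [[u nu]|U0] := pselect (exists u, (~` BU) u); last first.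
  rewrite (_ : ~` BU = set0); first exact: connected0.
  by apply/seteqP; split=> u //= nu; apply: U0; exists u.
have [p pu] := to_surface_repr u; pose x0 := to_surface R M (ctr (tag p)).
have reach k : connected_component (~` BU) x0 (to_surface R M (ctr k)).
  have /porbitP[i ->] := W (tag p) k.
  elim: i => [|i IHi].
    by rewrite expg0 perm1; apply: connected_component_refl => /BU_onB/ctr_onB.
  by rewrite expgSr permM; apply: connected_component_trans IHi (ctr_walk _).
have -> : ~` BU = connected_component (~` BU) x0.
  apply/seteqP; split; last exact: connected_component_sub.
  move=> v nv; have [q qv] := to_surface_repr v; rewrite -qv in nv *.
  by apply: connected_component_trans (reach (tag q)) (to_ctr _) => /BU_onB.
exact: component_connected.
Qed.

End Topology.

Definition eset n (B : {set ground n}) : {set 'I_n} := [set j | inl j \in B]%SET.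

Lemma map_base_walk (R : realType) n (M : smap n) (B : {set ground n}) :
  map_base R M B <->
  admissible B /\ forall h k, k \in porbit (walk M (eset B)) h.
Proof.
have Be j : (j \in eset B) = (inl j \in B) by rewrite inE.
split=> -[Badm H]; split=> //; last exact: walk_connected H.
exact: connected_walk H.
Qed.

Lemma admissible_card n (B : {set ground n}) :
  (forall j, (inl j \in B) != (inr j \in B)) -> admissible B.
Proof.
move=> HB; split=> //; rewrite -sum1_card big_mkcond big_sumType /= -big_split /=.
rewrite (eq_bigr (fun=> 1%N)) ?sum1_card ?card_ord// => i _.
by have := HB i; do 2!case: (_ \in B).
Qed.

Lemma symdiffE (T : finType) (B C : {set T}) x :
  (x \in symdiff B C) = (x \in B) (+) (x \in C).
Proof. by rewrite !inE; do 2!case: (_ \in _). Qed.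

Definition lab n (x : ground n) : 'I_n := match x with inl j => j | inr j => j end.

Lemma porbits_mulr_tperm (T : finType) (g : {perm T}) x y :
  (#|porbits (g * tperm x y)| + (x \notin porbit g y).*2
     = #|porbits g| + (x != y))%N.
Proof.
have tE : (tperm x y * g^-1 = (g * tperm x y)^-1)%g by rewrite invMg tpermV.
by have := porbits_mul_tperm (g^-1)%g x y; rewrite /= tE porbitV !porbitsV.
Qed.

Lemma porbits1P (T : finType) (g : {perm T}) (x0 : T) :
  (forall h k, k \in porbit g h) <-> #|porbits g| = 1%N.
Proof.
split=> [H|/eqP/cards1P[C gC] h k].
  apply/eqP/cards1P; exists (porbit g x0); apply/setP => C; rewrite !inE.
  apply/imsetP/eqP => [[x _ ->]|->]; last by exists x0.
  by apply/eqP; rewrite eq_porbit_mem H.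
have inC x : porbit g x = C.
  by apply/set1P; rewrite -gC imset_f.
by rewrite (inC h) -(inC k) porbit_id.
Qed.

Section Exchange.
Variables (n : nat) (M : smap n).
Local Notation eat := (edge_at M).

Lemma cyc_at j h : cyc M j h = if eat h == j then alpha M h else h.
Proof.
rewrite -edge_atE; case: ifPn => [/alpha_moved //|]; first by rewrite negbK => /eqP.
Qed.

Lemma eat_walk e h : eat (walk M e h) = eat (sigma M h).
Proof. by rewrite walkE; case: ifP; rewrite ?edge_at_alpha. Qed.

Definition flip (e : {set 'I_n}) j : {set 'I_n} := [set i | (i \in e) (+) (i == j)]%SET.

Lemma walk_cyc e j : (walk M e * cyc M j)%g = walk M (flip e j).
Proof.
apply/permP => h; rewrite permM cyc_at eat_walk !walkE inE.
by case: eqP => _; case: ifP => //= _; rewrite alphaK.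
Qed.

Lemma walk_exchange e1 e2 j :
  (forall h k, k \in porbit (walk M e1) h) ->
  (forall h k, k \in porbit (walk M e2) h) ->
  (j \in e1) != (j \in e2) ->
  exists k, [/\ k != j, (k \in e1) != (k \in e2) &
    forall h l, l \in porbit (walk M (flip (flip e1 j) k)) h].
Proof.
move=> W1 W2 j12; have [x [y [xy jE]]] := cyc_transp M j.
pose u := walk M (flip e1 j).
have u2 : #|porbits u| = 2.
  have := porbits_mulr_tperm (walk M e1) x y.
  rewrite -jE walk_cyc W1 xy /= => H.
  by have /(porbits1P _ x) E := W1; rewrite E addn0 in H.
have [k /and3P[kj k12 /existsP[z kz]]] : exists k,
    [&& k != j, (k \in e1) != (k \in e2) & [exists z, cyc M k z \notin porbit u z]].
  apply/existsP; apply: contraT => /existsPn H.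
  suff : #|porbits u| = 1%N by rewrite u2.
  apply/(porbits1P _ x).
  have step h : walk M e2 h \in porbit u h.
    have uh : u h \in porbit u h by have := mem_porbit u 1 h; rewrite expg1.
    have [ij|ij] := eqVneq (eat (sigma M h)) j.
      suff -> : walk M e2 h = u h by [].
      rewrite !walkE inE ij eqxx; move: j12.
      by case: (j \in e1); case: (j \in e2).
    set i := eat (sigma M h) in ij *.
    have [i12|i12] := eqVneq (i \in e1) (i \in e2).
      suff -> : walk M e2 h = u h by [].
      by rewrite !walkE inE -/i (negbTE ij) addbF i12.
    have := H i; rewrite ij i12 /= => /existsPn/(_ (u h)).
    rewrite negbK => ci.
    have <- : cyc M i (u h) = walk M e2 h.
      rewrite cyc_at eat_walk eqxx !walkE inE -/i (negbTE ij) addbF.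
      by case: (i \in e1) i12; case: (i \in e2) => // _; rewrite alphaK.
    by move: ci; rewrite porbit_step.
  move=> h k; have /porbitP[m ->] := W2 h k.
  elim: m => [|m IHm]; first by rewrite expg0 perm1 porbit_id.
  rewrite expgSr permM; move: IHm; rewrite -eq_porbit_mem => /eqP E.
  by rewrite -E; exact: step.
exists k; split=> //; rewrite -walk_cyc -/u.
have [a [b [ab kE]]] := cyc_transp M k.
apply/(porbits1P _ x).
have nab : a \notin porbit u b.
  apply: contra kz => abu; rewrite kE; case: tpermP => [->|->|_ _].
  - by rewrite porbit_sym.
  - exact: abu.
  - exact: porbit_id.
have := porbits_mulr_tperm u a b; rewrite -kE nab ab u2 => E.
by apply/eqP; rewrite -(eqn_add2r 2) E.
Qed.

Lemma map_base_exchange (R : realType) (B1 B2 : {set ground n}) (x : ground n) :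
  map_base R M B1 -> map_base R M B2 -> x \in symdiff B1 B2 ->
  exists2 y, y \in symdiff B2 B1 &
    map_base R M (symdiff B1 [set x; y; star x; star y]%SET).
Proof.
move=> /map_base_walk[A1 W1] /map_base_walk[A2 W2]; rewrite symdiffE => xB.
have xE : (lab x \in eset B1) != (lab x \in eset B2).
  rewrite !inE; case: x xB => j /=; first by do 2!case: (_ \in _).
  by have := A1.2 j; have := A2.2 j; do 4!case: (_ \in _).
have [k [kj k12 W]] := walk_exchange W1 W2 xE.
exists (inl k); first by rewrite symdiffE addbC; move: k12; rewrite !inE; do 2!case: (_ \in _).
set S := [set _; _; _; _]%SET; apply/map_base_walk.
have ll i j : (inl i == inl j :> ground n) = (i == j) by [].
have rr i j : (inr i == inr j :> ground n) = (i == j) by [].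
have lr i j : (inl i == inr j :> ground n) = false by [].
have rl i j : (inr i == inl j :> ground n) = false by [].
have SE (z : ground n) : (z \in S) = (lab z == lab x) (+) (lab z == k).
  have : (z \in S) = (lab z == lab x) || (lab z == k).
    rewrite !inE; case: x {xB xE kj W S} => j; case: z => i /=;
      by rewrite ?(ll, rr, lr, rl) ?orbF; do 2!case: eqP.
  by move=> ->; have [->|] := eqVneq (lab z) (lab x); rewrite //= eq_sym (negbTE kj).
split.
  apply: admissible_card => i; rewrite !symdiffE !SE /=.
  move: ((i == lab x) (+) (i == k)) (A1.2 i) => b.
  by case: b; do 2!case: (_ \in B1).
rewrite (_ : eset _ = flip (flip (eset B1) (lab x)) k)//.
by apply/setP => i; rewrite [LHS]inE symdiffE SE /= !inE addbA.
Qed.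

End Exchange.

End MapBaseFacts.

Lemma map_base_admissible (R : realType) n (M : smap n) (B : {set ground n}) :
  map_base R M B -> admissible B.
Proof. by case. Qed.

Definition Delta (R : realType) n (M : smap n) : lagrangian_matroid n :=
  @LagrangianMatroid n (map_base R M) (@map_base_admissible R n M)
    (@MapBaseFacts.map_base_exchange n M R).

Section Representation.
Variables (F : fieldType) (n : nat).
Implicit Types X Y : 'M[F]_n.

(* The columns of (X|Y) indexed by B, in the order of 1, ..., n, 1^*, ..., n^*.
   The default of [nth] is not reached when B has n elements. *)
Definition minor_on X Y (B : {set ground n}) : F :=
  \det (colsub (fun k : 'I_n => unsplit (nth (inl k) (enum B) k))
    (row_mx X Y)).

Record represents X Y (L : lagrangian_matroid n) : Prop := Represents {
  rep_rank : \rank (row_mx X Y) = n;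
  rep_antisym : (X *m Y^T)^T = - (X *m Y^T);
  rep_bases : forall B, admissible B -> (bases L B <-> minor_on X Y B != 0)
}.

(* (replace_cols A X Y | replace_cols A Y X) is (X|Y) with the columns j and
   j^* interchanged for all j in A. *)
Definition replace_cols (A : {set 'I_n}) X Y : 'M[F]_n :=
  \matrix_(i, j) if j \in A then Y i j else X i j.

End Representation.

(* Main.v *)
(* Both constructions apply the involution of [n] + [n]^* that exchanges j and
   j^* for j in A. On the matrix side this permutes columns, so a maximal minor
   on B becomes, up to sign, the minor on the image of B. On the map side, B is
   a base iff sigma * c_e is transitive, where e is the set of edges in B and
   c_e the product of their transpositions; for the partial dual this is
   sigma * c_A * c_e = sigma * c_(A symdiff e), and A symdiff e is the set of
   edges in the image of B. *)
Require Import Defs.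
From mathcomp Require Import all_boot all_order all_algebra all_fingroup.
From mathcomp Require Import all_classical all_reals all_analysis.

Set Implicit Arguments.
Unset Strict Implicit.
Unset Printing Implicit Defensive.

Import GRing.Theory.
Import MapBaseFacts.
Local Open Scope ring_scope.

Section SwapStar.
Variables (n : nat) (A : {set 'I_n}).

Definition swap_star (b : ground n) : ground n :=
  if lab b \in A then star b else b.

Lemma swap_starK : involutive swap_star.
Proof. by case=> j; rewrite /swap_star /=; case jA: (j \in A); rewrite /= jA. Qed.

Lemma mem_swap_star (B : {set ground n}) b :
  (b \in (swap_star @: B)%SET) = (swap_star b \in B).
Proof. by rewrite -{1}(swap_starK b) (mem_imset _ _ (inv_inj swap_starK)). Qed.

Lemma admissible_swap_star (B : {set ground n}) :
  admissible B -> admissible (swap_star @: B)%SET.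
Proof.
case=> _ HB; apply: admissible_card => j; rewrite !mem_swap_star /swap_star /=.
by case: ifP => _; rewrite // eq_sym.
Qed.

(** For [j] in [A] the image contains the edge [j] exactly when [B] contains the coedge; by
    admissibility this means that [B] omits the edge. *)
Lemma eset_swap_star (B : {set ground n}) : admissible B ->
  eset (swap_star @: B)%SET = [set j | (j \in A) (+) (j \in eset B)]%SET.
Proof.
case=> _ HB; apply/setP => j; rewrite !inE mem_swap_star /swap_star /=.
by have := HB j; case: (j \in A); do 2!case: (_ \in B).
Qed.

End SwapStar.

(** Each of the two products applies [alpha] or nothing at a half-edge. Since [alpha] stays on the
    same edge and is an involution, two applications cancel, which yields the exclusive or. *)
Lemma walk_partial_dual n (M : smap n) (A e : {set 'I_n}) :
  walk (partial_dual M A) e = walk M [set j | (j \in A) (+) (j \in e)]%SET.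
Proof.
have cE : Defs.cprod (partial_dual M A) e = Defs.cprod M e by [].
apply/permP => h; rewrite /walk cE /= !permM !cprod_at inE.
case: (boolP (edge_at M _ \in A)) => _ /=; last by [].
by rewrite edge_at_alpha; case: ifP => //= _; rewrite alphaK.
Qed.

Lemma map_base_partial_dual (R : realType) n (M : smap n) (A : {set 'I_n})
    (B : {set ground n}) : admissible B ->
  map_base R (partial_dual M A) B <-> map_base R M (swap_star A @: B)%SET.
Proof.
move=> HB; have HB' := admissible_swap_star A HB.
split=> /map_base_walk[_ W]; apply/map_base_walk; split=> //; move: W;
  by rewrite walk_partial_dual eset_swap_star.
Qed.

Section ReplaceCols.
Variables (F : fieldType) (n : nat) (A : {set 'I_n}) (X Y : 'M[F]_n).

Lemma row_mx_replace_cols i (b : ground n) :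
  row_mx (replace_cols A X Y) (replace_cols A Y X) i (unsplit b) =
  row_mx X Y i (unsplit (swap_star A b)).
Proof.
by case: b => j; rewrite /swap_star /= ?row_mxEl ?row_mxEr mxE;
  case: ifP => _ /=; rewrite ?row_mxEl ?row_mxEr.
Qed.

Lemma rank_replace_cols :
  \rank (row_mx (replace_cols A X Y) (replace_cols A Y X)) =
  \rank (row_mx X Y).
Proof.
(* This is [swap_star] carried over to the column indices of the block matrix; being an involution,
   it defines a permutation of the columns. *)
pose f (k : 'I_(n + n)) := unsplit (swap_star A (fintype.split k)).
have fK : cancel f f by move=> k; rewrite /f unsplitK swap_starK splitK.
rewrite (_ : row_mx _ _ = col_perm (perm (can_inj fK)) (row_mx X Y)).
  by rewrite col_permE mxrankMfree// row_free_unit unitmx_perm.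
by apply/matrixP => i k; rewrite [RHS]mxE permE -row_mx_replace_cols splitK.
Qed.

(** Anti-symmetry says that the sums over [j] of [X i j * Y k j + X k j * Y i j] vanish, and each
    summand is unchanged when [X] and [Y] trade their [j]-th columns. *)
Lemma antisym_replace_cols : (X *m Y^T)^T = - (X *m Y^T) ->
  (replace_cols A X Y *m (replace_cols A Y X)^T)^T =
  - (replace_cols A X Y *m (replace_cols A Y X)^T).
Proof.
move=> /eqP; rewrite -addr_eq0 => /eqP XY; apply/eqP; rewrite -addr_eq0.
apply/eqP; rewrite -XY; apply/matrixP => i k; rewrite !mxE -!big_split /=.
apply: eq_bigr => j _; rewrite !mxE; case: ifP => _ //.
by rewrite addrC mulrC [X in _ + X]mulrC.
Qed.

Lemma minor_on_replace_cols (B : {set ground n}) : #|B| = n ->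
  (minor_on (replace_cols A X Y) (replace_cols A Y X) B != 0) =
  (minor_on X Y (swap_star A @: B)%SET != 0).
Proof.
move=> cB; set B' := (_ @: _)%SET.
have sB : size (enum B) == n by rewrite -cardE cB.
have cB' : #|B'| = n by rewrite card_imset//; exact/inv_inj/swap_starK.
have sB' : size (enum B') == n by rewrite -cardE cB'.
(* [swap_star] need not preserve the order in which [enum] lists a set; [s] sends the position of
   [b] in [B] to that of its image in [B']. Its signature is the sign between the two minors. *)
have /tuple_permP[s sE] :
    perm_eq (map_tuple (swap_star A) (Tuple sB)) (Tuple sB').
  apply: uniq_perm => [||b] /=; rewrite ?enum_uniq//.
    by rewrite map_inj_uniq ?enum_uniq//; exact/inv_inj/swap_starK.
  rewrite mem_enum mem_swap_star -{1}(swap_starK A b).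
  by rewrite mem_map ?mem_enum//; exact/inv_inj/swap_starK.
rewrite /minor_on.
set C := colsub _ (row_mx X Y).
rewrite (_ : colsub _ _ = col_perm s C).
  by rewrite col_permE det_mulmx det_perm mulf_eq0 signr_eq0 orbF.
apply/matrixP => i k; rewrite [LHS]mxE 2![RHS]mxE row_mx_replace_cols.
congr (row_mx X Y i (unsplit _)).
(* The default [inl (s k)] is chosen to agree with the one in column [s k] of [C]; the index is in
   range, so its value is immaterial. *)
rewrite -(nth_map _ (inl (s k))) ?(eqP sB)//.
have /= -> := sE.
by rewrite (nth_map k) ?size_enum_ord// nth_ord_enum (tnth_nth (inl (s k))).
Qed.

End ReplaceCols.

Theorem theorem4p1 (R : realType) (F : fieldType) (n : nat) (M : smap n)
    (A : {set 'I_n}) (X Y : 'M[F]_n) :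
  [pchar F] =i pred0 ->
  represents X Y (Delta R M) ->
  represents (replace_cols A X Y) (replace_cols A Y X)
    (Delta R (partial_dual M A)).
Proof.
move=> _ [rankXY antiXY basesXY]; split=> [||B HB].
- by rewrite rank_replace_cols.
- exact: antisym_replace_cols.
- rewrite minor_on_replace_cols ?HB.1//.
  apply: iff_trans (map_base_partial_dual R M A HB) _.
  exact/basesXY/admissible_swap_star.
Qed.
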